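(* Let $a,b,m\ge1$ and let $\{(\mathbf{x}^j,\mathbf{y}^j):1\le j\le m\}$ be a strong $3$-sum $(a,b)$-system in $\{0,1,2\}^{<\mathbb{N}}$. For each $j$ let $a_j=|S_{\mathbf{x}^j}\setminus S_{\mathbf{y}^j}|$, $b_j=|S_{\mathbf{y}^j}\setminus S_{\mathbf{x}^j}|$, $c_j=|S_{\mathbf{x}^j}\cap S_{\mathbf{y}^j}|$. Then \[ \sum_{j=1}^m\frac{a_j!\,b_j!\,c_j!}{(a_j+b_j+c_j)!}=\sum_{j=1}^m\frac{1}{\binom{a_j+b_j+c_j}{a_j+b_j}\binom{a_j+b_j}{a_j}}\le\min(a,b). \]
   Context: $\{0,1,2\}^{<\mathbb{N}}$ is the set of infinite sequences with entries in $\{0,1,2\}$ and finite support $S_{\mathbf{x}}=\{i:x_i\ne0\}$. For $\mathbf{x},\mathbf{y}$ put $|\mathbf{x}\cap_3\mathbf{y}|=|\{i:x_i+y_i\ge3\}|$. A strong $3$-sum $(a,b)$-system is a system of pairs $(\mathbf{x}^j,\mathbf{y}^j)$, $j=1,\dots,m$, with $|\mathbf{x}^j\cap_3\mathbf{y}^j|=0$ for all $j$, $|\mathbf{x}^i\cap_3\mathbf{y}^j|\ne0$ for all $i\ne j$, and $|S_{\mathbf{x}^j}|\le a$, $|S_{\mathbf{y}^j}|\le b$ for all $j$. *)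

(* Defs.v *)
From HB Require Import structures.
From mathcomp Require Import all_boot all_order all_algebra finmap.

Set Implicit Arguments.
Unset Strict Implicit.
Unset Printing Implicit Defensive.

Local Open Scope fset_scope.

Definition ternary_seq := {fsfun nat -> 'I_3 with ord0}.

Definition supp (x : ternary_seq) : {fset nat} := finsupp x.

(* The set {i : nat | x_i + y_i >= 3}. Filtering the union of the supports
   loses no index: outside of it x_i + y_i = 0. *)
Definition cap3 (x y : ternary_seq) : {fset nat} :=
  [fset i in supp x `|` supp y | (3 <= x i + y i)%N].

(* Strong 3-sum (a, b)-system; the pairs are indexed by 0, ..., m - 1. *)
Definition strong_3sum_system (a b m : nat) (x y : 'I_m -> ternary_seq) : Prop :=
  [/\ forall j, #|` cap3 (x j) (y j)| = 0,
      forall i j, i != j -> #|` cap3 (x i) (y j)| <> 0,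
      forall j, (#|` supp (x j)| <= a)%N
    & forall j, (#|` supp (y j)| <= b)%N].

(* Main.v *)
(** Write X_j, Y_j for the supports and A = X \ Y, B = Y \ X, C = X & Y.
    The system conditions say that X_i & Y_j is never contained in X_j & Y_i.
    Order the ground set at random and let E(j, y) be the event that y is the
    maximum of X_j and lies below all of B_j.  For a fixed order the pairs
    (A_j, C_j \ y) of the events that hold are weakly cross-intersecting:
    if max X_i <= max X_j, a point of X_i & Y_j outside X_j & Y_i cannot be in
    B_j, so it lies in A_i & C_j.  By Tuza's weighting argument such pairs
    satisfy sum g(|A_j|, |C_j \ y|) <= g(0, 0) for every g >= 0 with
    g(l, r) = g(l + 1, r) + g(l, r + 1).  Averaging over the orders and choosing
    g well gives the bound by a; exchanging x and y gives the bound by b. *)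

Require Import Defs.
From mathcomp Require Import all_boot all_order all_algebra finmap.
From mathcomp Require Import zify ring lra.

Set Implicit Arguments.

Import Order.TTheory GRing.Theory Num.Theory.

Local Open Scope ring_scope.

(** * Pascal weights and random subsets *)

(** The Beta integral of t^l (1 - t)^r over [0, 1]: the probability that, in a random order of l + r
    + 1 elements, a given element has a given set of l others below it and the remaining r above
    it. *)
Definition beta (l r : nat) : rat := l`!%:R * r`!%:R / ((l + r).+1)`!%:R.

(** Think of [g l r] as the weight of the random sets that contain l prescribed points and avoid r
    others; one further point is either contained or avoided. *)
Definition pascal (g : nat -> nat -> rat) := forall l r, g l r = g l.+1 r + g l r.+1.

Lemma factr_neq0 n : n`!%:R != 0 :> rat.
Proof. by rewrite pnatr_eq0 -lt0n fact_gt0. Qed.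

Lemma factSr n : (n.+1)`!%:R = n.+1%:R * n`!%:R :> rat.
Proof. by rewrite factS natrM. Qed.

Lemma beta_ge0 l r : 0 <= beta l r.
Proof. by rewrite divr_ge0 ?mulr_ge0 ?ler0n. Qed.

Lemma pascal_beta : pascal beta.
Proof.
move=> l r; rewrite /beta addSn addnS !factSr.
have := factr_neq0 (l + r); set f := (l + r)`!%:R => f0.
have e1 : (l + r).+1%:R = l%:R + r%:R + 1 :> rat by rewrite -natr1 natrD.
have e2 : (l + r).+2%:R = l%:R + r%:R + 2 :> rat by rewrite -natr1 e1; ring.
have := ler0n rat l; have := ler0n rat r => r0 l0.
rewrite e1 e2 -!natr1; field.
by rewrite f0 andTb; apply/andP; split; apply/eqP; lra.
Qed.

(** Induction on the number of points outside [A] and [C]: such a point lies in [S] or not, and the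
    Pascal rule merges the two cases. The rule is assumed only for [r] at least [#|C|] because
    [sum_beta_event] applies this to [beta l r.-1], for which it fails at [r = 0]. *)
Lemma sum_interval (T : finType) (A C : {set T}) (g : nat -> nat -> rat) :
  [disjoint A & C] ->
  (forall l r, (#|C| <= r)%N -> g l r = g l.+1 r + g l r.+1) ->
  \sum_(S : {set T} | (A \subset S) && (C \subset ~: S)) g #|S| #|~: S|
    = g #|A| #|C|.
Proof.
have [n] := ubnP #|~: (A :|: C)|; elim: n A C => // n IHn A C.
rewrite ltnS => leACn dAC gP.
have [/eqP|[z]] := set_0Vmem (~: (A :|: C)).
  rewrite -setCT (inj_eq (@setC_inj _)) => /eqP UAC.
  have CA : C = ~: A.
    apply/setP=> t; have := in_setT t; rewrite -UAC !inE.
    by case tA: (t \in A) => //= _; apply: (disjointFr dAC).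
  rewrite (big_pred1 A) ?CA // => S /=.
  by rewrite setCS eq_sym eqEsubset.
rewrite !inE negb_or => /andP[zA zC].
have ltn (B : {set T}) : A :|: C \proper B -> (#|~: B| < n)%N.
  by move=> pB; rewrite (leq_trans _ leACn) // proper_card // properC.
rewrite (bigID (fun S : {set T} => z \in S)) /= gP //.
have -> : #|A|.+1 = #|z |: A| by rewrite cardsU1 zA.
have cC : #|C|.+1 = #|z |: C| by rewrite cardsU1 zC.
rewrite cC -IHn; last first.
- by move=> l r /gP.
- by rewrite disjoints_subset subUset sub1set inE zC -disjoints_subset.
- apply: ltn; rewrite properEneq setSU ?subsetUr // andbT.
  apply/eqP=> /setP/(_ z); rewrite !inE eqxx (negPf zA) (negPf zC) //.
rewrite -[in RHS]IHn; last first.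
- by move=> l r le; apply: gP; rewrite ltnW // cC.
- by rewrite disjoint_sym disjoints_subset subUset sub1set inE zA -disjoints_subset disjoint_sym.
- apply: ltn; rewrite properEneq setUS ?subsetUr // andbT.
  apply/eqP=> /setP/(_ z); rewrite !inE eqxx (negPf zA) (negPf zC) //.
congr (_ + _); apply: eq_bigl => S; rewrite subUset sub1set ?inE.
  by rewrite andbC andbA.
by rewrite andbC andbCA.
Qed.

(* A set S chosen with weight g #|S| #|~: S| contains A k and avoids C k
   for at most one k. *)
Lemma sum_cross_intersecting (T K : finType) (P : pred K) (A C : K -> {set T})
    (g : nat -> nat -> rat) :
  (forall l r, 0 <= g l r) -> pascal g ->
  (forall k, P k -> [disjoint A k & C k]) ->
  (forall k k', P k -> P k' -> k != k' ->
     (A k :&: C k' != set0) || (A k' :&: C k != set0)) ->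
  \sum_(k | P k) g #|A k| #|C k| <= g 0%N 0%N.
Proof.
move=> g0 gP dAC AC.
have sumT : \sum_(S : {set T}) g #|S| #|~: S| = g 0%N 0%N.
  have := @sum_interval T set0 set0 g; rewrite cards0 => <- //.
  - by apply: eq_bigl => S; rewrite !sub0set.
  - by rewrite -setI_eq0 setI0.
rewrite -sumT.
under eq_bigr => k Pk do
  rewrite -(@sum_interval T (A k) (C k) g (dAC k Pk) (fun l r _ => gP l r)).
rewrite (exchange_big_dep predT) //=; apply: ler_sum => S _.
case: (pickP (fun k => [&& P k, A k \subset S & C k \subset ~: S])) => [k0|no].
  move=> /and3P[Pk0 Ak0 Ck0]; rewrite (big_pred1 k0) // => k /=.
  apply/and3P/eqP => [[Pk Ak Ck]|-> //]; apply: contraTeq isT => neq.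
  have meet0 (B D : {set T}) : B \subset S -> D \subset ~: S -> B :&: D = set0.
    move=> BS DS; apply/eqP; rewrite -subset0 -(setICr S).
    exact: setISS.
  by have := AC _ _ Pk Pk0 neq; rewrite !meet0 // eqxx.
by rewrite big1 // => k; have := no k => /= ->.
Qed.

(** * Averaging over random orders *)

(* The sequence lists an order from the top down. *)
Fixpoint chain_sum (T : finType) (h : T -> {set T} -> rat) (s : seq T) : rat :=
  if s is y :: s' then h y [set x in s'] + chain_sum h s' else 0.

Lemma chain_sumE (T : finType) (h : T -> {set T} -> rat) (s : seq T) :
  uniq s -> chain_sum h s =
  \sum_(y <- s) h y [set x in s | (index y s < index x s)%N].
Proof.
elim: s => [|y s IHs] /= => [_|/andP[ys us]]; first by rewrite big_nil.
rewrite big_cons IHs //; congr (_ + _).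
  congr (h y _); apply/setP=> x; rewrite !inE eqxx [y == x]eq_sym.
  by case: (eqVneq x y) => [->|_] /=; rewrite ?(negPf ys) ?andbT.
apply: eq_big_seq => z zs; congr (h z _); apply/setP=> x; rewrite !inE.
have /negPf-> : y != z by apply: contraNneq ys => ->.
by rewrite [y == x]eq_sym; case: (eqVneq x y) => [->|xy] /=; rewrite ?(negPf ys).
Qed.

(* For a uniformly random order of U, the elements preceding y form the set L
   with probability beta #|L| #|U :\ y :\: L|. *)
Lemma chain_sum_average (T : finType) (h : T -> {set T} -> rat) (c : rat)
    (U : {set T}) :
  (forall s, uniq s -> [set x in s] = U -> chain_sum h s <= c) ->
  \sum_(y in U) \sum_(L : {set T} | L \subset U :\ y)
     beta #|L| #|U :\ y :\: L| * h y L <= c.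
Proof.
have [n] := ubnP #|U|; elim: n U c => // n IHn U c; rewrite ltnS => leUn hc.
have [U0|[y0 y0U]] := set_0Vmem U.
  by rewrite U0 big_set0; apply: (hc [::]) => //; rewrite U0; apply/setP=> x; rewrite !inE.
have U0 : (0 < #|U|)%N by apply/card_gt0P; exists y0.
have Un0 : #|U|%:R != 0 :> rat by rewrite pnatr_eq0 -lt0n.
(* Condition on the top element [y]: what remains is a random order of [U :\ y]. *)
have step y : y \in U ->
    \sum_(z in U :\ y) \sum_(L : {set T} | L \subset U :\ y :\ z)
       beta #|L| #|U :\ y :\ z :\: L| * h z L <= c - h y (U :\ y).
  move=> yU; apply: IHn; first by rewrite (leq_trans _ leUn) // [X in (_ < X)%N](cardsD1 y) yU.
  move=> s us sU; rewrite lerBrDl; have := hc (y :: s); rewrite /= sU; apply.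
    by rewrite us andbT; have /setP/(_ y) := sU; rewrite !inE eqxx => ->.
  by apply/setP=> x; have /setP/(_ x) := sU; rewrite !inE => ->; case: eqVneq => // ->.
have : \sum_(y in U) (h y (U :\ y) + \sum_(z in U :\ y) \sum_(L : {set T} | L \subset U :\ y :\ z)
       beta #|L| #|U :\ y :\ z :\: L| * h z L) <= \sum_(y in U) c.
  by apply: ler_sum => y /step; lra.
rewrite sumr_const -mulr_natl -ler_pdivrMl ?ltr0n //.
apply: le_trans; rewrite le_eqVlt; apply/orP; left; apply/eqP.
rewrite big_split /= (exchange_big_dep (mem U)) /=; last first.
  by move=> y z _; rewrite !inE => /andP[].
rewrite -big_split mulr_sumr; apply: eq_bigr => z zU /=.
have cU : #|U| = #|U :\ z|.+1 by rewrite (cardsD1 z) zU.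
rewrite (exchange_big_dep (fun L : {set T} => L \subset U :\ z)) /=; last first.
  by move=> y L _ /subset_trans; apply; apply: setSD; rewrite subsetDl.
(* For [L = U :\ z] the point [z] is itself on top, which has probability 1 / |U| =
   [beta #|L| 0]. *)
rewrite (bigD1 (U :\ z)) //= [in RHS](bigD1 (U :\ z)) //=.
rewrite [X in _ = _ * (_ + (X + _))]big1 ?add0r; last first.
  move=> y /andP[/andP[yU]]; rewrite !inE => /andP[zy _] /subsetP/(_ y).
  by rewrite !inE eqxx yU [y == z]eq_sym zy /= => /(_ isT).
rewrite mulrDr; congr (_ + _).
  rewrite setDv cards0 /beta addn0 mulr1 cU factSr; congr (_ * _).
  have := factr_neq0 #|U :\ z|; rewrite cU in Un0 => f0.
  by rewrite invfM mulrCA divff // mulr1.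
(* For any other [L] the top element is one of the r points of [U :\ z :\: L], and r * beta l (r -
   1) = (l + r + 1) * beta l r with l = |L|. *)
rewrite mulr_sumr; apply: eq_bigr => L /andP[LU neqL].
have cD : (#|L| + #|U :\ z :\: L|)%N = #|U :\ z|.
  by rewrite cardsD (setIidPr LU) subnKC // subset_leq_card.
rewrite (eq_big (mem (U :\ z :\: L)) (fun=> beta #|L| #|U :\ z :\: L|.-1 * h z L)) /=; first last.
- move=> y /andP[/andP[yU]]; rewrite !inE => /andP[zy _] sL; congr (beta _ _ * _).
  rewrite [in RHS](cardsD1 y) !inE yU eq_sym zy.
  have -> : y \notin L by apply/negP=> /(subsetP sL); rewrite !inE eqxx andbF.
  by rewrite /=; apply: eq_card => x; rewrite !inE; case: (x == y); case: (x == z); case: (x \in L).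
- move=> y; rewrite !inE zU andbT [z == y]eq_sym.
  case: (eqVneq y z) => [->|yz] /=; first by rewrite !andbF.
  case: (boolP (y \in U)) => yU; rewrite ?andbF //=.
  rewrite andbT; apply/idP/idP => [sL|yL].
    by apply/negP=> /(subsetP sL); rewrite !inE eqxx andbF.
  apply/subsetP=> x xL; have := subsetP LU _ xL; rewrite !inE => /andP[-> ->].
  by rewrite andbT; apply: contraNneq yL => <-.
rewrite sumr_const -[in RHS]mulrnAl mulrA; congr (_ * _).
have : (0 < #|U :\ z :\: L|)%N.
  rewrite lt0n cards_eq0 setD_eq0; apply: contra neqL => UL.
  by rewrite eqEsubset LU.
rewrite cU -cD; case: #|_ :\: _| => // r _ /=.
rewrite -[beta _ r *+ _]mulr_natl /beta addnS !factSr.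
have n1 k : k.+1%:R != 0 :> rat by rewrite pnatr_eq0.
have := factr_neq0 (#|L| + r); move: (n1 (#|L| + r)%N) (n1 (#|L| + r).+1%N).
set p := _.+1%:R; set q := _.+2%:R; set f := _`!%:R => p0 q0 f0.
by clearbody p q f; move: (r.+1%:R) (#|L| `!%:R) (r`!%:R) => v1 v2 v3; field; rewrite p0 q0 f0.
Qed.

(** * Cross-intersection for a fixed order *)

Lemma chain_event_bound (T K : finType) (X Y : K -> {set T})
    (g : nat -> nat -> rat) (s : seq T) :
  (forall l r, 0 <= g l r) -> pascal g ->
  (forall i j, i != j -> ~~ (X i :&: Y j \subset X j :&: Y i)) ->
  uniq s -> [set t in s] = setT ->
  chain_sum (fun y L => \sum_(j | [&& y \in X j, X j :\ y \subset L
                                   & Y j :\: X j \subset ~: L])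
               g #|X j :\: Y j| #|(X j :&: Y j) :\ y|) s <= g 0%N 0%N.
Proof.
move=> g0 gP XY us sT; rewrite chain_sumE //.
have sE : s =i predT by move=> t; have /setP/(_ t) := sT; rewrite !inE.
rewrite (perm_big (index_enum T)) /=; last first.
  by apply: uniq_perm => //; [exact: index_enum_uniq | move=> t; rewrite sE mem_index_enum].
rewrite pair_big_dep /=.
apply: (@sum_cross_intersecting T (T * K)%type _
  (fun k => X k.2 :\: Y k.2) (fun k => (X k.2 :&: Y k.2) :\ k.1)) => //.
  by move=> k _; rewrite -setI_eq0; apply/eqP/setP=> t; rewrite !inE; case: (t \in Y _); rewrite ?andbF.
have below y i t : X i :\ y \subset [set x in s | (index y s < index x s)%N] ->
    t \in X i -> (index y s <= index t s)%N.
  move=> /subsetP sX tX; have [->//|ty] := eqVneq t y.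
  by have := sX t; rewrite !inE ty tX => /(_ isT)/andP[_ /ltnW].
have eqi y t : index y s = index t s -> y = t.
  by move=> e; rewrite -(nth_index y (_ : y \in s)) ?sE // e nth_index ?sE.
(* the witness t of i against j is below max X i, hence below max X j,
   so it cannot lie in Y j :\: X j *)
have key yi i yj j : i != j ->
    X i :\ yi \subset [set x in s | (index yi s < index x s)%N] ->
    Y j :\: X j \subset ~: [set x in s | (index yj s < index x s)%N] ->
    yj \in X j -> (index yj s <= index yi s)%N ->
    exists2 t, (t \in X i :\: Y i) && (t \in X j :&: Y j) & t = yj -> yi = yj.
  move=> ij Xi Bj yjX le; have /subsetPn[t] := XY _ _ ij.
  rewrite !inE => /andP[tXi tYj] nt.
  have ti := below _ _ _ Xi tXi.
  have tXj : t \in X j.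
    apply: contraT => ntXj; have := subsetP Bj t; rewrite !inE ntXj tYj sE /=.
    rewrite -leqNgt => /(_ isT) tj.
    (* The complement of the set below [yj] contains [yj] itself, so the case [t = yj] survives the
       comparison and is excluded by [yj \in X j]. *)
    have e : t = yj by apply: eqi; lia.
    by rewrite e yjX in ntXj.
  exists t; first by rewrite !inE tXj tYj tXi !andbT; rewrite tXj in nt.
  by move=> e; apply: eqi; rewrite -e in le *; lia.
move=> [yi i] [yj j] /= /and3P[yiX Xi Bi] /and3P[yjX Xj Bj] neq.
(* Two events with the same [j] name the same maximum of [X j]. *)
have [eij|ij] := eqVneq i j.
  subst j; move: neq; rewrite xpair_eqE eqxx andbT => /eqP[]; apply: eqi.
  by have := below _ _ _ Xi yjX; have := below _ _ _ Xj yiX; lia.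
wlog le : yi i yj j yiX Xi Bi yjX Xj Bj neq ij / (index yj s <= index yi s)%N.
  move=> W; case: (leqP (index yj s) (index yi s)) => [le|/ltnW le].
    exact: (W yi i yj j).
  by rewrite orbC; apply: (W yj j yi i) => //; rewrite eq_sym.
have [t tAC tyj] := key _ _ _ _ ij Xi Bj yjX le.
(* The witness fails only if it is the point [yj] removed from the second set. Then the two maxima
   coincide, so [key] also applies with [i] and [j] exchanged; its witness lies outside [Y j],
   whereas [yj] is in [Y j], so it is not the removed point. *)
have [te|tne] := eqVneq t yj; last first.
  by apply/orP; left; apply/set0Pn; exists t; move: tAC; rewrite !inE tne => /andP[-> ->].
have yij := tyj te; subst t yi; apply/orP; right.
have [t tAC' _] : exists2 t, (t \in X j :\: Y j) && (t \in X i :&: Y i) & t = yj -> yj = yj.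
  by apply: key => //; rewrite eq_sym.
have tne : t != yj.
  by apply/eqP=> e; move: tAC tAC'; rewrite e !inE; case: (yj \in Y j); rewrite ?andbF.
by apply/set0Pn; exists t; move: tAC'; rewrite !inE tne => /andP[-> ->].
Qed.

(** * The choice of the weight *)

(* The coefficients make weight00 hold and make weight_bound an equality at
   (p, q) = (k + 2, 0) and (p, q) = (0, k + 2). *)
Definition weight (k l r : nat) : rat :=
  let D : rat := k%:R ^+ 2 + 3 * k%:R + 1 in
  k%:R * (k%:R + 3) / D * beta l r
  + (k%:R + 1) / ((k%:R + 2) * D) * (r == 0%N)%:R
  + ((k%:R + 2) * D)^-1 * (l == 0%N)%:R.

Lemma weight_denom_gt0 k : 0 < k%:R ^+ 2 + 3 * k%:R + 1 :> rat.
Proof. have k0 : 0 <= k%:R :> rat by exact: ler0n.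
by nra. Qed.

Lemma weight_ge0 k l r : 0 <= weight k l r.
Proof.
have D0 := ltW (weight_denom_gt0 k).
have k0 : 0 <= k%:R :> rat by exact: ler0n.
have b0 := beta_ge0 l r.
by rewrite /weight; do ![apply: addr_ge0 => // | apply: mulr_ge0 => // | rewrite invr_ge0 | exact: ler0n].
Qed.

(** The indicators of [r = 0] and [l = 0] are the weights of choosing always the full set or always
    the empty set, so [weight k] is a mixture of three Pascal weights. *)
Lemma pascal_weight k : pascal (weight k).
Proof. by move=> l r; rewrite /weight pascal_beta /= !eqE /=; ring. Qed.

Lemma weight00 k : weight k 0 0 = 1.
Proof.
have D0 := weight_denom_gt0 k.
have k0 : 0 <= k%:R :> rat by exact: ler0n.
rewrite /weight (_ : beta 0 0 = 1) //= ?eqxx; field.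
by apply/andP; split; apply/eqP; lra.
Qed.

Lemma weightE k p q : weight k p q * ((k%:R + 2) * (k%:R ^+ 2 + 3 * k%:R + 1))
  = k%:R * (k%:R + 2) * (k%:R + 3) * beta p q
    + (k%:R + 1) * (q == 0%N)%:R + (p == 0%N)%:R.
Proof.
have D0 := weight_denom_gt0 k.
have k0 : 0 <= k%:R :> rat by exact: ler0n.
rewrite /weight; field.
by apply/andP; split; apply/eqP; lra.
Qed.

(** Used with k + 2 = a, p = |A_j| and q = |C_j|; the two summands on the right collect the maxima
    lying in C_j and in A_j. With n = p + q <= k + 2, it follows from 1 <= (k + 2) / n and 1 <= (k +
    3) / (n + 1). The indicators in [weight] are needed for p = 0, q = 0 and q = 1; elsewhere the
    [beta] part suffices. *)
Lemma weight_bound k p q : (0 < p + q <= k.+2)%N ->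
  p`!%:R * q`!%:R <= k.+2%:R * (p + q).-1`!%:R *
    (q%:R * weight k p q.-1 + p%:R * weight k p q).
Proof.
move=> /andP[n0 nk].
have D0 := weight_denom_gt0 k.
have k0 : 0 <= k%:R :> rat by exact: ler0n.
have -> : k.+2%:R = k%:R + 2 :> rat by rewrite -addn2 natrD.
rewrite -(ler_pM2r D0).
have -> : (k%:R + 2) * (p + q).-1`!%:R *
    (q%:R * weight k p q.-1 + p%:R * weight k p q) * (k%:R ^+ 2 + 3 * k%:R + 1)
  = (p + q).-1`!%:R * (q%:R * (weight k p q.-1 * ((k%:R + 2) * (k%:R ^+ 2 + 3 * k%:R + 1)))
     + p%:R * (weight k p q * ((k%:R + 2) * (k%:R ^+ 2 + 3 * k%:R + 1)))) :> rat by ring.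
rewrite !weightE {D0}.
have nkr : p%:R + q%:R <= k%:R + 2 :> rat by rewrite -!natrD ler_nat addn2.
have p0 : 0 <= p%:R :> rat by exact: ler0n.
have q0 : 0 <= q%:R :> rat by exact: ler0n.
have f0 n : 0 < n`!%:R :> rat by rewrite ltr0n fact_gt0.
case: q => [|q] in n0 nk nkr q0 *.
  case: p => [//|p] in n0 nk nkr p0 *.
  rewrite /beta addn0 /= fact0 !factSr -[in p.+2%:R]natr1 mulr1.
  have p1 : 1 <= p.+1%:R :> rat by rewrite ler1n.
  have := f0 p; move: (p`!%:R) (p.+1%:R) p1 nkr => f x x1 xk f1.
  move: (k%:R) k0 xk => c c0 xk.
  have -> : x * f / ((x + 1) * (x * f)) = (x + 1)^-1.
    by field; rewrite !lt0r_neq0 //; lra.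
  have v1 : 1 <= (x + 1)^-1 * (c + 3) by rewrite ler_pdivlMl; lra.
  have c2 : 0 <= c + 2 by lra.
  have h : c * (c + 2) * 1 <= c * (c + 2) * ((x + 1)^-1 * (c + 3)) by rewrite ler_wpM2l // mulr_ge0.
  have xf0 : 0 <= x * f by rewrite mulr_ge0 // ?ltW //; lra.
  have h2 : c ^+ 2 + 3 * c + 1 <= c * (c + 2) * (c + 3) * (x + 1)^-1 + (c + 1) by lra.
  by have := ler_wpM2l xf0 h2; lra.
rewrite addnS /= mulr0 addr0.
set F : rat := (p + q)`!%:R; set c : rat := k%:R; set n : rat := (p + q).+1%:R.
have nE : n = p%:R + q.+1%:R by rewrite -natrD addnS.
have F0 : 0 < F by exact: f0.
set G : rat := p`!%:R * (q.+1)`!%:R.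
have G0 : 0 < G by rewrite mulr_gt0.
have n0r : 0 < n by rewrite ltr0n.
have b1 : F * (q.+1%:R * beta p q) = G * n^-1.
  rewrite /beta /G !factSr -/F -/n; move: F n q.+1%:R F0 n0r {nE G G0} => F' n' x F0 n0r.
  by field; rewrite !lt0r_neq0.
have b2 : F * beta p q.+1 = G * (n^-1 * (n + 1)^-1).
  rewrite /beta addnS !(factSr (p + q).+1) (factSr (p + q)) -/F -[(p + q).+2%:R]natr1 -/n -/G.
  move: F n G F0 n0r {nE b1 G0} => F' n' G' F0 n0r.
  by field; rewrite !lt0r_neq0 //; lra.
have v1 : 1 <= n^-1 * (c + 2) by rewrite ler_pdivlMl // mulr1 nE.
have w1 : 1 <= (n + 1)^-1 * (c + 3) by rewrite ler_pdivlMl; rewrite /c; lra.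
have -> : F * (q.+1%:R * (c * (c + 2) * (c + 3) * beta p q + (c + 1) * (q == 0%N)%:R + (p == 0%N)%:R)
    + p%:R * (c * (c + 2) * (c + 3) * beta p q.+1 + (p == 0%N)%:R))
  = c * (c + 2) * (c + 3) * (F * (q.+1%:R * beta p q) + p%:R * (F * beta p q.+1))
    + F * q.+1%:R * ((c + 1) * (q == 0%N)%:R + (p == 0%N)%:R) + F * (p%:R * (p == 0%N)%:R) by ring.
rewrite b1 b2.
have -> : p%:R * (p == 0%N)%:R = 0 :> rat by case: (p) => [|?]; rewrite ?mul0r ?mulr0.
rewrite mulr0 addr0.
have c0 : 0 <= c by [].
have c2 : 0 <= c + 2 by lra.
have c3 : 0 <= c + 3 by lra.
have v0 : 0 < n^-1 by rewrite invr_gt0.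
have w0 : 0 < (n + 1)^-1 by rewrite invr_gt0; lra.
have vn : n^-1 * n = 1 by rewrite mulVf // lt0r_neq0.
have wn : (n + 1)^-1 * (n + 1) = 1 by rewrite mulVf // lt0r_neq0 //; lra.
move: {b1 b2} (n^-1) ((n + 1)^-1) v1 w1 v0 w0 vn wn => v w v1 w1 v0 w0 vn wn.
have [p00|pn0] := eqVneq p 0%N.
  have FG : F * q.+1%:R = G by rewrite /F /G p00 add0n factSr fact0; ring.
  have h : c ^+ 2 + 3 * c + 1 <= c * (c + 2) * (c + 3) * v + 1.
    have : c * (c + 3) * 1 <= c * (c + 3) * (v * (c + 2)) by rewrite ler_wpM2l // mulr_ge0.
    lra.
  have := ler_wpM2l (ltW G0) h; rewrite FG p00 !mul0r addr0 /=.
  have : 0 <= G * ((c + 1) * (q == 0%N)%:R) by rewrite mulr_ge0 ?(ltW G0) // mulr_ge0 ?addr_ge0 ?ler0n.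
  lra.
have p1 : 1 <= p%:R :> rat by rewrite ler1n lt0n.
(* The original second argument is now [q.+1], so [q = 0] is the case in which the indicator
   survives only in [weight k p q.-1]. *)
rewrite addr0; have [q00|qn0] := eqVneq q 0%N.
  have FG : F = G by rewrite /F /G q00 addn0 mulr1.
  have e : v + p%:R * (v * w) = 2 * w.
    have -> : p%:R = n - 1 :> rat by rewrite nE q00; ring.
    have ew : v * (w * (n + 1)) = v by rewrite wn mulr1.
    have ev : v * n * w = w by rewrite vn mul1r.
    by lra.
  have h : c ^+ 2 + 3 * c + 1 <= c * (c + 2) * (c + 3) * (2 * w) + (c + 1).
    have : c * (c + 2) * 1 <= c * (c + 2) * (w * (c + 3)) by rewrite ler_wpM2l // mulr_ge0.
    by have := mulr_ge0 c0 c0; lra.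
  have := ler_wpM2l (ltW G0) h; rewrite -e FG q00 /= ?mulr1n; clearbody G c; lra.
(* Now n >= 3, so k >= 1. The first [beta] term gives at least k (k + 3) and the second at least k,
   which supplies the missing 1. *)
have c1 : 1 <= c by rewrite ler1n; lia.
have h1 : c * (c + 3) * 1 <= c * (c + 3) * (v * (c + 2)) by rewrite ler_wpM2l // mulr_ge0.
have h2 : 1 <= (v * (c + 2)) * (w * (c + 3)) by rewrite mulr_ege1.
have h : c ^+ 2 + 3 * c + 1 <= c * (c + 2) * (c + 3) * (v + p%:R * (v * w)).
  have A0 : 0 <= c * (c + 2) * (c + 3) by rewrite !mulr_ge0.
  have h3 : v * w <= p%:R * (v * w) by rewrite ler_peMl // mulr_ge0 // ltW.
  have := ler_wpM2l A0 h3; have := ler_wpM2l c0 h2; lra.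
have := ler_wpM2l (ltW G0) h; rewrite !mulr0 addr0; clearbody G c; lra.
Qed.

(** * The bound for set systems *)

(* The probability that, in a random order, y is the maximum of X and
   precedes all of B. *)
Lemma sum_beta_event (T : finType) (X B : {set T}) (y : T) :
  [disjoint X & B] -> y \in X ->
  \sum_(L : {set T} | (L \subset setT :\ y) && ((X :\ y \subset L) && (B \subset ~: L)))
     beta #|L| #|setT :\ y :\: L| = beta #|X|.-1 #|B|.
Proof.
move=> dXB yX; have yB : y \notin B by rewrite (disjointFr dXB).
(* Adding [y] to the avoided set makes the condition on [L] an interval; the predecessor in [r.-1]
   discounts [y] again. *)
have := @sum_interval T (X :\ y) (y |: B) (fun l r => beta l r.-1).
rewrite cardsU1 yB /= (cardsD1 y X) yX /= => <-; last first.
- by move=> l [|r] //= _; rewrite pascal_beta.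
- rewrite disjoint_sym disjoints_subset subUset sub1set !inE eqxx /=.
  rewrite -disjoints_subset disjoint_sym; apply: disjointWl dXB; exact: subsetDl.
apply: eq_big => L.
  rewrite subUset sub1set inE subsetD1 subsetT /= andbCA; done.
rewrite subsetD1 subsetT /= => /andP[yL _]; congr (beta _ _).
rewrite [in RHS](cardsD1 y) inE yL /=; apply: eq_card => t.
by rewrite !inE; case: (t \in L); rewrite ?andbF.
Qed.

Lemma sum_setD1_cardI (T : finType) (X Y : {set T}) (f : nat -> rat) :
  \sum_(y in X) f #|(X :&: Y) :\ y|
    = #|X :&: Y|%:R * f #|X :&: Y|.-1 + #|X :\: Y|%:R * f #|X :&: Y|.
Proof.
rewrite (big_setID Y) /=; congr (_ + _).
  rewrite (eq_bigr (fun=> f #|X :&: Y|.-1)) => [|y yI].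
    by rewrite sumr_const mulr_natl.
  by rewrite [in RHS](cardsD1 y) yI.
rewrite (eq_bigr (fun=> f #|X :&: Y|)) => [|y].
  by rewrite sumr_const mulr_natl.
rewrite inE => /andP[yY _]; rewrite [in RHS](cardsD1 y) inE (negPf yY) andbF //.
Qed.

(** The fixed-order bound averaged over all orders. The probability of E(j, y) is the same for every
    y in X_j; only the weight depends on whether y lies in Y_j. *)
Lemma sum_beta_weight (T K : finType) (X Y : K -> {set T})
    (g : nat -> nat -> rat) :
  (forall l r, 0 <= g l r) -> pascal g ->
  (forall i j, i != j -> ~~ (X i :&: Y j \subset X j :&: Y i)) ->
  \sum_j beta #|X j|.-1 #|Y j :\: X j| *
      (#|X j :&: Y j|%:R * g #|X j :\: Y j| #|X j :&: Y j|.-1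
       + #|X j :\: Y j|%:R * g #|X j :\: Y j| #|X j :&: Y j|)
    <= g 0%N 0%N.
Proof.
move=> g0 gP XY.
have := @chain_sum_average T _ (g 0%N 0%N) setT
  (fun s us sT => @chain_event_bound T K X Y g s g0 gP XY us sT).
apply: le_trans; rewrite le_eqVlt; apply/orP; left; apply/eqP.
transitivity (\sum_(y in [set: T]) \sum_(j | y \in X j)
   g #|X j :\: Y j| #|(X j :&: Y j) :\ y| * beta #|X j|.-1 #|Y j :\: X j|).
  rewrite (exchange_big_dep predT) //=; apply: eq_bigr => j _.
  rewrite -sum_setD1_cardI mulr_sumr.
  by apply: eq_big => y; rewrite ?inE // mulrC.
apply: eq_bigr => y _.
under [RHS]eq_bigr => L _ do rewrite mulr_sumr.
rewrite (exchange_big_dep (fun j => y \in X j)) /=; last by move=> L j _ /andP[].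
apply: eq_bigr => j yX; rewrite -(@sum_beta_event T (X j) _ y) //; last first.
  by rewrite -setI_eq0; apply/eqP/setP=> t; rewrite !inE; case: (t \in X j); rewrite ?andbF.
by rewrite mulr_sumr; apply: eq_big => L; rewrite ?yX // mulrC.
Qed.

(** Termwise comparison: multiplying the inequality for [g] at p = |A_j|, q = |C_j| by |B_j|! / |X_j
    | Y_j|! turns its right side into a times the j-th term of [sum_beta_weight]. *)
Lemma multinomial_sum_bound (T K : finType) (X Y : K -> {set T}) (a : nat) :
  (0 < a)%N -> (forall j, 0 < #|X j| <= a)%N ->
  (forall i j, i != j -> ~~ (X i :&: Y j \subset X j :&: Y i)) ->
  \sum_j ((#|X j :\: Y j|)`!%:R * (#|Y j :\: X j|)`!%:R * (#|X j :&: Y j|)`!%:R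
     / (#|X j :\: Y j| + #|Y j :\: X j| + #|X j :&: Y j|)`!%:R) <= a%:R :> rat.
Proof.
move=> a0 Xa XY.
have [g [g0 gP g00 gb]] : exists g : nat -> nat -> rat,
   [/\ forall l r, 0 <= g l r, pascal g, g 0%N 0%N = 1
     & forall p q, (0 < p + q <= a)%N ->
       p`!%:R * q`!%:R <= a%:R * (p + q).-1`!%:R *
          (q%:R * g p q.-1 + p%:R * g p q)].
  case: a a0 {Xa} => [//|[|k]] _; last first.
    exists (weight k); split; [exact: weight_ge0|exact: pascal_weight|exact: weight00|exact: weight_bound].
  (* For a = 1 only (p, q) = (1, 0) and (0, 1) occur, and the indicator alone gives equality at
     both. *)
  exists (fun _ r => (r == 0%N)%:R); split => //.
  - by move=> l r; rewrite addr0.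
  - by move=> [|[|p]] [|[|q]].
have := @sum_beta_weight T K X Y g g0 gP XY; rewrite g00 => h.
rewrite -[leRHS]mulr1; have := ler_wpM2l (ler0n rat a) h; apply: le_trans.
rewrite mulr_sumr; apply: ler_sum => j _.
have cX : #|X j| = (#|X j :\: Y j| + #|X j :&: Y j|)%N.
  by rewrite -(cardsID (Y j) (X j)) addnC.
have := gb #|X j :\: Y j| #|X j :&: Y j|; rewrite -cX => /(_ (Xa j)) gj.
have X0 : (0 < #|X j|)%N by case/andP: (Xa j).
rewrite /beta addnAC -cX -addSn prednK //.
set M : rat := (#|Y j :\: X j|)`!%:R; set N : rat := (#|X j| + _)`!%:R.
have MN : 0 <= M / N by rewrite divr_ge0 // ler0n.
have := ler_wpM2r MN gj.
set P : rat := _ * g _ _ + _.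
set u : rat := (#|X j|.-1)`!%:R; set v : rat := (#|X j :\: Y j|)`!%:R.
set w : rat := (#|X j :&: Y j|)`!%:R.
by clearbody P u v w M N; congr (_ <= _); ring.
Qed.

(** * From ternary sequences to their supports *)

Local Open Scope fset_scope.

Lemma cap3C x y : cap3 x y = cap3 y x.
Proof. by apply/fsetP=> i; rewrite !inE orbC addnC. Qed.

Lemma strong_3sum_systemC a b m (x y : 'I_m -> ternary_seq) :
  strong_3sum_system a b x y -> strong_3sum_system b a y x.
Proof.
case=> xy0 xy xa yb; split=> // [j|i j ij]; rewrite cap3C //.
by apply: xy; rewrite eq_sym.
Qed.

(** Where x^i + y^j >= 3, both entries are nonzero and one of them is 2. If x^j and y^i were nonzero
    there too, x^i + y^i <= 2 and x^j + y^j <= 2 would force all four entries to be 1. *)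
Lemma strong_3sum_system_notsub a b m (x y : 'I_m -> ternary_seq) i j :
  strong_3sum_system a b x y -> i != j ->
  exists t, [/\ t \in supp (x i), t \in supp (y j)
               & ~~ ((t \in supp (x j)) && (t \in supp (y i)))].
Proof.
case=> xy0 xy _ _ ij; have /eqP := xy _ _ ij.
rewrite cardfs_eq0 => /fset0Pn[t]; rewrite !inE /= => /andP[_ h3].
have no k : (x k t + y k t < 3)%N.
  have /cardfs0_eq/fsetP/(_ t)/negbT := xy0 k; rewrite !inE /= ltnNge negb_and.
  case/orP=> [|/negPn //]; rewrite negb_or /supp !memNfinsupp.
  by case/andP=> /eqP-> /eqP->.
have nz (z : ternary_seq) : (t \in supp z) = (0 < z t)%N.
  by rewrite mem_finsupp lt0n.
exists t; have := no i; have := no j; rewrite !nz.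
have := ltn_ord (x i t); have := ltn_ord (y j t).
by move=> ? ? ? ?; split; lia.
Qed.

Lemma card_restrict_fset N (D : {fset nat}) :
  {in D, forall t, (t < N)%N} -> #|[set i : 'I_N | val i \in D]| = #|` D|.
Proof.
move=> DN; rewrite cardE -(size_map val).
apply/perm_size/uniq_perm; rewrite ?fset_uniq ?map_inj_uniq ?enum_uniq //.
  exact: val_inj.
move=> t; apply/mapP/idP => [[i]|tD]; first by rewrite mem_enum inE => iD ->.
by exists (Ordinal (DN _ tD)); rewrite // mem_enum inE.
Qed.

Lemma strong_3sum_bound a b m (x y : 'I_m -> ternary_seq) :
  (0 < a)%N -> strong_3sum_system a b x y ->
  \sum_(j < m) (((#|` supp (x j) `\` supp (y j)|)`! * (#|` supp (y j) `\` supp (x j)|)`!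
                 * (#|` supp (x j) `&` supp (y j)|)`!)%N%:R
     / (#|` supp (x j) `\` supp (y j)| + #|` supp (y j) `\` supp (x j)|
        + #|` supp (x j) `&` supp (y j)|)`!%:R) <= a%:R :> rat.
Proof.
move=> a0 sys.
(* An empty support has no maximum. But it meets no [supp (y i)], so such a pair is the only one and
   its term equals 1. *)
have [j /eqP xj0|xn0] := pickP (fun j => supp (x j) == fset0).
  have all_j i : i = j.
    apply/eqP; apply: contraT; rewrite eq_sym => ij.
    by have [t []] := @strong_3sum_system_notsub a b m x y _ _ sys ij; rewrite xj0.
  rewrite (big_pred1 j) => [|i]; last by rewrite (all_j i) /= eqxx.
  rewrite xj0 fset0D fset0I fsetD0 cardfs0 fact0 mul1n muln1 add0n addn0.
  by rewrite divff ?factr_neq0 // ler1n.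
(* Exceeds every index in any support, so all supports embed in ['I_N]. *)
pose N := (\max_(j < m) \max_(t <- supp (x j) `|` supp (y j)) t).+1.
have leN j t : t \in supp (x j) `|` supp (y j) -> (t < N)%N.
  move=> tj; rewrite ltnS; apply: leq_trans (leq_bigmax j).
  by rewrite (big_rem t) //= leq_maxl.
pose X j := [set i : 'I_N | val i \in supp (x j)].
pose Y j := [set i : 'I_N | val i \in supp (y j)].
have cXY (D : {fset nat}) j : {subset D <= supp (x j) `|` supp (y j)} ->
    #|[set i : 'I_N | val i \in D]| = #|` D|.
  by move=> sD; apply: card_restrict_fset => t /sD /leN.
have sX j : {subset supp (x j) <= supp (x j) `|` supp (y j)}.
  by move=> t tx; rewrite inE tx.
have cA j : #|` supp (x j) `\` supp (y j)| = #|X j :\: Y j|.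
  rewrite -(cXY _ j) => [|t]; first by apply: eq_card => i; rewrite !inE.
  by rewrite !inE => /andP[_ ->].
have cB j : #|` supp (y j) `\` supp (x j)| = #|Y j :\: X j|.
  rewrite -(cXY _ j) => [|t]; first by apply: eq_card => i; rewrite !inE.
  by rewrite !inE => /andP[_ ->]; rewrite orbT.
have cC j : #|` supp (x j) `&` supp (y j)| = #|X j :&: Y j|.
  rewrite -(cXY _ j) => [|t]; first by apply: eq_card => i; rewrite !inE.
  by rewrite !inE => /andP[->].
have cX j : #|X j| = #|` supp (x j)| by apply: (cXY _ j).
have XY i j : i != j -> ~~ (X i :&: Y j \subset X j :&: Y i).
  move=> ij; have [t [tx ty nt]] := @strong_3sum_system_notsub a b m x y _ _ sys ij.
  apply/subsetPn; exists (Ordinal (leN i t (sX i t tx))); rewrite !inE /= ?tx ?ty //.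
have Xa j : (0 < #|X j| <= a)%N.
  by case: sys => _ _ xa _; rewrite cX xa andbT lt0n cardfs_eq0 xn0.
have := @multinomial_sum_bound 'I_N 'I_m X Y a a0 Xa XY.
by under eq_bigr => j _ do rewrite -cA -cB -cC -!natrM.
Qed.

Theorem theorem3p2 (a b m : nat) (x y : 'I_m -> ternary_seq) :
  (1 <= a)%N -> (1 <= b)%N -> (1 <= m)%N ->
  strong_3sum_system a b x y ->
  let a_ j := #|` supp (x j) `\` supp (y j)| in
  let b_ j := #|` supp (y j) `\` supp (x j)| in
  let c_ j := #|` supp (x j) `&` supp (y j)| in
  let S : rat :=
    \sum_(j < m) (((a_ j)`! * (b_ j)`! * (c_ j)`!)%N%:R
                  / ((a_ j + b_ j + c_ j)`!)%N%:R) in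
  let T : rat :=
    \sum_(j < m) (1 / ('C(a_ j + b_ j + c_ j, a_ j + b_ j)
                       * 'C(a_ j + b_ j, a_ j))%N%:R) in
  S = T /\ T <= (minn a b)%:R.
Proof.
move=> a0 b0 _ sys a_ b_ c_ S T.
have ST : S = T.
  apply: eq_bigr => j _.
  move: (a_ j) (b_ j) (c_ j) => p q r.
  have e1 := bin_fact (leq_addr r (p + q)); have e2 := bin_fact (leq_addr q p).
  rewrite addKn in e1; rewrite addKn in e2; rewrite -e1 -e2 mul1r.
  have n0 : (p`! * q`! * r`!)%:R != 0 :> rat.
    by rewrite pnatr_eq0 -lt0n !muln_gt0 !fact_gt0.
  have -> : ('C(p + q + r, p + q) * ('C(p + q, p) * (p`! * q`!) * r`!)
     = (p`! * q`! * r`!) * ('C(p + q + r, p + q) * 'C(p + q, p)))%N by lia.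
  by rewrite (natrM _ (_ * r`!)) invfM mulrA divff // mul1r.
split=> //; rewrite -ST.
have Sa : S <= a%:R by exact: (@strong_3sum_bound a b).
have Sb : S <= b%:R.
  have := strong_3sum_bound b0 (strong_3sum_systemC sys).
  apply: le_trans; rewrite le_eqVlt; apply/orP; left; apply/eqP.
  apply: eq_bigr => j _; rewrite fsetIC -/(a_ j) -/(b_ j) -/(c_ j).
  by rewrite [(b_ j + a_ j)%N]addnC [((b_ j)`! * _)%N]mulnC.
by rewrite /minn; case: ifP.
Qed.
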